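(* Let $R$ be a ring, $G$ a finite group acting on $R$, $H$ a subgroup of $G$, and $n\ge0$ an integer. Then $\mathrm{nCt\text{-}gldim}(RH)\le\mathrm{nCt\text{-}gldim}(RG)$, and equality holds when $RG$ is a separable extension over $RH$.
   Context: Rings are associative with identity; modules are unitary and are left modules unless otherwise specified. $G$ acts on $R$ by ring automorphisms: $r\mapsto g(r)$ is a ring automorphism for each $g\in G$, $(g_1g_2)(r)=g_1(g_2(r))$ and $1(r)=r$. The skew group ring $RG$ is the free left $R$-module with basis $G$ and multiplication $(ag)(bh)=a\,g(b)\,gh$ for $a,b\in R$, $g,h\in G$. For a subgroup $H\le G$ (with the restricted action), $RH$ is a subring of $RG$. A ring $A$ is a separable extension over a subring $S$ if the multiplication map $A\otimes_S A\to A$, $a\otimes b\mapsto ab$, splits as a map of $A$-$A$-bimodules; i.e. there is $\sum_i a_i\otimes b_i\in A\otimes_S A$ with $\sum_i a_i\otimes b_i a=\sum_i a a_i\otimes b_i$ for all $a\in A$ and $\sum_i a_ib_i=1$. The left $n$-cotorsion dimension $\mathrm{nCtd}_A(M)$ of an $A$-module $M$ is the smallest integer $k\ge0$ such that $\operatorname{Ext}^{k+1}_A(F,M)=0$ for every $A$-module $F$ of flat dimension at most $n$ ($\infty$ if no such $k$ exists). The left global $n$-cotorsion dimension $\mathrm{nCt\text{-}gldim}(A)$ is the supremum of $\mathrm{nCtd}_A(M)$ over all left $A$-modules $M$. *)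

(* Defs.v *)
From HB Require Import structures.
From mathcomp Require Import all_boot all_order all_algebra all_fingroup.
From mathcomp Require Import boolp.

Set Implicit Arguments.
Unset Strict Implicit.
Unset Printing Implicit Defensive.

Import GRing.Theory.

Local Open Scope ring_scope.
Local Open Scope quotient_scope.

Local Notation repr := generic_quotient.repr.

(* [Some k] is the natural number [k] and [None] is infinity. *)
Definition enat := option nat.

Declare Scope enat_scope.
Delimit Scope enat_scope with enat.
Bind Scope enat_scope with enat.

Definition enat_le (x y : enat) : bool :=
  match x, y with
  | _, None => true
  | None, Some _ => false
  | Some m, Some n => (m <= n)%N
  end.

Notation "x <= y" := (enat_le x y) : enat_scope.

Definition enat_min (P : nat -> Prop) : enat :=
  match pselect (exists k, `[< P k >]) with
  | left exP => Some (ex_minn exP)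
  | right _ => None
  end.

Definition enat_sup (I : Type) (u : I -> enat) : enat :=
  enat_min (fun k => forall i, (u i <= Some k)%enat).

Lemma enat_minP (P : nat -> Prop) (n : nat) :
  (enat_min P <= Some n)%enat <-> exists2 k, (k <= n)%N & P k.
Proof.
rewrite /enat_min; case: pselect => [exP|nexP] /=.
- case: ex_minnP => m /asboolP Pm min_m; split; first by exists m.
  by case=> k le_kn /asboolP Pk; apply: leq_trans le_kn; apply: min_m.
- by split=> // -[k _ Pk]; case: nexP; exists k; apply/asboolP.
Qed.

Lemma enat_sup_ub (I : Type) (u : I -> enat) (i : I) :
  (u i <= enat_sup u)%enat.
Proof.
rewrite /enat_sup /enat_min; case: pselect => [exP|_] /=; last by case: (u i).
by case: ex_minnP => m /asboolP + _; apply.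
Qed.

Lemma enat_sup_least (I : Type) (u : I -> enat) (b : enat) :
  (forall i, (u i <= b)%enat) -> (enat_sup u <= b)%enat.
Proof.
case: b => [b|] ub; last by case: (enat_sup u).
by apply/enat_minP; exists b.
Qed.

Section Presentation.
Variables (X : choiceType).

(* A word is a formal sum of signed generators; [true] stands for [-]. *)
Definition word := seq (bool * X).

Variable E : word -> word -> Prop.

(* The least congruence on words that contains [E], makes the concatenation
   commutative and makes [+ x] and [- x] opposite. *)
Inductive word_eq : word -> word -> Prop :=
| WordRefl s : word_eq s s
| WordSym s t : word_eq s t -> word_eq t s
| WordTrans s t u : word_eq s t -> word_eq t u -> word_eq s u
| WordCat s s' t t' : word_eq s s' -> word_eq t t' -> word_eq (s ++ t) (s' ++ t')
| WordComm s t : word_eq (s ++ t) (t ++ s)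
| WordNeg x : word_eq [:: (false, x); (true, x)] [::]
| WordRel s t : E s t -> word_eq s t.

Definition word_eqb (s t : word) : bool := `[< word_eq s t >].

Lemma word_eqb_refl : reflexive word_eqb.
Proof. by move=> s; apply/asboolP; apply: WordRefl. Qed.

Lemma word_eqb_sym : symmetric word_eqb.
Proof.
by move=> s t; apply/idP/idP => /asboolP st; apply/asboolP; apply: WordSym.
Qed.

Lemma word_eqb_trans : transitive word_eqb.
Proof.
by move=> t s u /asboolP st /asboolP tu; apply/asboolP; apply: WordTrans tu.
Qed.

Canonical word_equiv :=
  EquivRel word_eqb word_eqb_refl word_eqb_sym word_eqb_trans.

Definition presented : Type := {eq_quot word_equiv}.
HB.instance Definition _ := Choice.on presented.
HB.instance Definition _ := EqQuotient.on presented.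

Definition word_opp (s : word) : word := [seq (~~ p.1, p.2) | p <- s].

Lemma word_oppl s : word_eq (word_opp s ++ s) [::].
Proof.
elim: s => [|[b x] s IHs] /=; first exact: WordRefl.
apply: (@WordTrans _ ([:: (~~ b, x)] ++ [:: (b, x)] ++ word_opp s ++ s)).
  rewrite -[(~~ b, x) :: _]cat1s -[(b, x) :: s]cat1s.
  apply: WordCat (WordRefl _) _; rewrite !catA.
  exact: WordCat (WordComm _ _) (WordRefl s).
rewrite catA -[X in word_eq _ X]cats0; apply: WordCat IHs.
case: b; first exact: WordNeg.
apply: WordTrans (WordNeg x).
exact: (WordComm [:: (true, x)] [:: (false, x)]).
Qed.

Lemma word_oppr s : word_eq (s ++ word_opp s) [::].
Proof. exact: WordTrans (WordComm _ _) (word_oppl s). Qed.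

Lemma word_eq_opp s t : word_eq s t -> word_eq (word_opp s) (word_opp t).
Proof.
move=> st; apply: (@WordTrans _ (word_opp s ++ t ++ word_opp t)).
  apply: WordSym; rewrite -[X in word_eq _ X]cats0.
  exact: WordCat (WordRefl _) (word_oppr t).
rewrite catA -[X in word_eq _ X]cat0s; apply: WordCat (WordRefl _).
apply: WordTrans (word_oppl s).
by apply: WordCat (WordRefl _) _; apply: WordSym.
Qed.

Definition pres_of (s : word) : presented := \pi_presented s.

Lemma pres_ofP s t : pres_of s = pres_of t <-> word_eq s t.
Proof.
split=> [/eqP|st]; first by rewrite eqmodE => /asboolP.
by apply/eqP; rewrite eqmodE; apply/asboolP.
Qed.

Lemma pres_ofK (x : presented) : pres_of (repr x) = x.
Proof. exact: reprK. Qed.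

Lemma word_eq_repr s : word_eq (repr (pres_of s)) s.
Proof. by apply/pres_ofP; rewrite pres_ofK. Qed.

Definition pres0 : presented := pres_of [::].
Definition pres_opp (x : presented) := pres_of (word_opp (repr x)).
Definition pres_add (x y : presented) := pres_of (repr x ++ repr y).

Lemma pres_addE s t : pres_add (pres_of s) (pres_of t) = pres_of (s ++ t).
Proof. by apply/pres_ofP; apply: WordCat; apply: word_eq_repr. Qed.

Lemma pres_oppE s : pres_opp (pres_of s) = pres_of (word_opp s).
Proof. by apply/pres_ofP; apply/word_eq_opp/word_eq_repr. Qed.

Lemma pres_addA : associative pres_add.
Proof.
move=> x y z; rewrite -[x]pres_ofK -[y]pres_ofK -[z]pres_ofK.
by rewrite !pres_addE catA.
Qed.

Lemma pres_addC : commutative pres_add.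
Proof. by move=> x y; apply/pres_ofP; apply: WordComm. Qed.

Lemma pres_add0 : left_id pres0 pres_add.
Proof. by move=> x; rewrite -[x]pres_ofK pres_addE. Qed.

Lemma pres_addN : left_inverse pres0 pres_opp pres_add.
Proof.
move=> x; rewrite -[x]pres_ofK pres_oppE pres_addE.
by apply/pres_ofP; apply: word_oppl.
Qed.

HB.instance Definition _ :=
  GRing.isZmodule.Build presented pres_addA pres_addC pres_add0 pres_addN.

Definition pres_gen (x : X) : presented := pres_of [:: (false, x)].

Lemma pres_ofD s t : pres_of (s ++ t) = pres_of s + pres_of t.
Proof. by rewrite -pres_addE. Qed.

Lemma pres_of_sum s :
  pres_of s = \sum_(p <- s) (if p.1 then - pres_gen p.2 else pres_gen p.2).
Proof.
elim: s => [|[b x] s IHs]; first by rewrite big_nil.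
rewrite big_cons -IHs -cat1s pres_ofD; congr (_ + _).
by case: b => //=; rewrite -[RHS]/(pres_opp _) pres_oppE.
Qed.

Variable V : zmodType.

Definition word_eval (f : X -> V) (s : word) : V :=
  \sum_(p <- s) (if p.1 then - f p.2 else f p.2).

(* The additive map induced by [f] on the generators; it is the expected one
   as soon as [f] is compatible with the relations, see [pres_liftE]. *)
Definition pres_lift (f : X -> V) (x : presented) : V := word_eval f (repr x).

Definition compatible (f : X -> V) :=
  forall s t, E s t -> word_eval f s = word_eval f t.

Lemma word_eval_eq f s t :
  compatible f -> word_eq s t -> word_eval f s = word_eval f t.
Proof.
move=> cf; rewrite /word_eval; elim=> {s t} //.
- by move=> s t u _ -> _ ->.
- by move=> s s' t t' _ es _ et; rewrite !big_cat /= es et.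
- by move=> s t; rewrite !big_cat /= addrC.
- by move=> x; rewrite !big_cons !big_nil /= addr0 subrr.
Qed.

Lemma pres_liftE f : compatible f ->
  forall s, pres_lift f (pres_of s) = word_eval f s.
Proof. by move=> cf s; apply: word_eval_eq cf (word_eq_repr s). Qed.

Lemma pres_liftD f : compatible f -> {morph pres_lift f : x y / x + y}.
Proof.
move=> cf x y; rewrite -[x]pres_ofK -[y]pres_ofK -pres_ofD !pres_liftE //.
by rewrite /word_eval big_cat.
Qed.

Lemma pres_lift_gen f : compatible f ->
  forall x, pres_lift f (pres_gen x) = f x.
Proof. by move=> cf x; rewrite pres_liftE // /word_eval big_seq1. Qed.

End Presentation.

(* Right [A]-modules are modules over the converse ring [A^c], so that
   [(a : A^c) *: x] is [x a]. *)
Section Tensor.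
Variables (A : pzRingType) (N : lmodType A^c) (M : lmodType A).

Inductive tensor_rel : word (N * M)%type -> word (N * M)%type -> Prop :=
| TensorDl x x' y :
    tensor_rel [:: (false, (x + x', y))] [:: (false, (x, y)); (false, (x', y))]
| TensorDr x y y' :
    tensor_rel [:: (false, (x, y + y'))] [:: (false, (x, y)); (false, (x, y'))]
| TensorBal x (a : A) y :
    tensor_rel [:: (false, ((a : A^c) *: x, y))] [:: (false, (x, a *: y))].

Definition tensor : Type := presented tensor_rel.
HB.instance Definition _ := GRing.Zmodule.on tensor.

Definition tens (x : N) (y : M) : tensor := pres_gen tensor_rel (x, y).

Lemma tensDl x x' y : tens (x + x') y = tens x y + tens x' y.
Proof. by rewrite -pres_ofD; apply/pres_ofP/WordRel/TensorDl. Qed.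

Lemma tensDr x y y' : tens x (y + y') = tens x y + tens x y'.
Proof. by rewrite -pres_ofD; apply/pres_ofP/WordRel/TensorDr. Qed.

Lemma tens_bal x (a : A) y : tens ((a : A^c) *: x) y = tens x (a *: y).
Proof. by apply/pres_ofP/WordRel/TensorBal. Qed.

End Tensor.

Section TensorMap.
Variables (A : pzRingType) (N' N : lmodType A^c) (M : lmodType A).
Variable f : {linear N' -> N}.

(* [f] tensored with the identity of [M] *)
Definition tensor_map : tensor N' M -> tensor N M :=
  pres_lift (fun p : N' * M => tens (f p.1) p.2).

Lemma tensor_map_compatible :
  compatible (@tensor_rel A N' M) (fun p : N' * M => tens (f p.1) p.2).
Proof.
move=> s t [x x' y|x y y'|x a y]; rewrite /word_eval !big_cons !big_nil /= !addr0.
- by rewrite linearD tensDl.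
- by rewrite tensDr.
- by rewrite linearZ tens_bal.
Qed.

Lemma tensor_mapD : {morph tensor_map : u v / u + v}.
Proof. exact/pres_liftD/tensor_map_compatible. Qed.

Lemma tensor_map_tens x y : tensor_map (tens x y) = tens (f x) y.
Proof. exact: (pres_lift_gen tensor_map_compatible (x, y)). Qed.

End TensorMap.

Section Homological.
Variable A : pzRingType.
Implicit Types F M P : lmodType A.

Definition flat M : Prop :=
  forall (N' N : lmodType A^c) (f : {linear N' -> N}),
    injective f -> injective (@tensor_map A N' N M f).

Definition projective P : Prop :=
  forall (M N : lmodType A) (p : {linear M -> N}) (f : {linear P -> N}),
    (forall y, exists x, p x = y) ->
    exists g : {linear P -> M}, forall x, p (g x) = f x.

(* ... -> C 2 -> C 1 -> C 0 -> M -> 0 exact, all terms satisfying [Q] *)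
Record resolution (Q : lmodType A -> Prop) (M : lmodType A) := Resolution {
  res_obj :> nat -> lmodType A;
  res_d : forall i, {linear res_obj i.+1 -> res_obj i};
  res_aug : {linear res_obj 0 -> M};
  res_objP : forall i, Q (res_obj i);
  res_aug_surj : forall y, exists x, res_aug x = y;
  res_exact0 : forall x, res_aug x = 0 <-> exists y, res_d 0 y = x;
  res_exact : forall i x, res_d i x = 0 <-> exists y, res_d i.+1 y = x
}.

Definition flat_dim M : enat :=
  enat_min (fun n => exists C : resolution flat M,
    forall i, (n < i)%N -> forall x : C i, x = 0).

Section Ext.
Variables (F M : lmodType A) (C : resolution projective F).

(* Cocycles and coboundaries are those of the complex Hom(C, M). *)
Definition cocycle k (f : {linear C k -> M}) : Prop :=
  forall x, f (res_d C k x) = 0.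

Definition coboundary k : {linear C k -> M} -> Prop :=
  match k with
  | 0 => fun f => forall x, f x = 0
  | k'.+1 => fun f =>
      exists g : {linear C k' -> M}, forall x, f x = g (res_d C k' x)
  end.

End Ext.

(* Ext^k(F, M) = 0, i.e. Hom(C, M) has no cohomology in degree k; this does
   not depend on the projective resolution C of F, and such a C exists by
   [projective_resolution_exists] below. *)
Definition Ext_vanishes k F M : Prop :=
  forall (C : resolution projective F) (f : {linear C k -> M}),
    cocycle f -> coboundary f.

Definition nCtd (n : nat) M : enat :=
  enat_min (fun k => forall F, (flat_dim F <= Some n)%enat ->
                               Ext_vanishes k.+1 F M).

End Homological.

Definition nCt_gldim (n : nat) (A : pzRingType) : enat :=
  enat_sup (fun M : lmodType A => nCtd n M).

Section FreeModule.
Variables (A : pzRingType) (X : choiceType).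

Inductive free_rel : word (A * X)%type -> word (A * X)%type -> Prop :=
| FreeD a b x :
    free_rel [:: (false, (a + b, x))] [:: (false, (a, x)); (false, (b, x))].

Definition free_mod : Type := presented free_rel.
HB.instance Definition _ := GRing.Zmodule.on free_mod.

Definition free_term (a : A) (x : X) : free_mod := pres_gen free_rel (a, x).

Lemma free_termD a b x : free_term (a + b) x = free_term a x + free_term b x.
Proof. by rewrite -pres_ofD; apply/pres_ofP/WordRel/FreeD. Qed.

Lemma free_mod_ind (K : free_mod -> Prop) :
  K 0 -> (forall u v, K u -> K v -> K (u + v)) -> (forall u, K u -> K (- u)) ->
  (forall a x, K (free_term a x)) -> forall u, K u.
Proof.
move=> K0 KD KN Kg u; rewrite -[u]pres_ofK pres_of_sum.
by elim/big_ind: _ => // -[[] [a x]] _ /=; [apply: KN|]; apply: Kg.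
Qed.

Definition free_scale (c : A) : free_mod -> free_mod :=
  pres_lift (fun p : A * X => free_term (c * p.1) p.2).

Lemma free_scale_compatible c :
  compatible free_rel (fun p : A * X => free_term (c * p.1) p.2).
Proof.
move=> s t [a b x]; rewrite /word_eval !big_cons !big_nil /= !addr0.
by rewrite mulrDr free_termD.
Qed.

Lemma free_scale_term c a x : free_scale c (free_term a x) = free_term (c * a) x.
Proof. exact: (pres_lift_gen (free_scale_compatible c) (a, x)). Qed.

Lemma free_scaleDr c : {morph free_scale c : u v / u + v}.
Proof. exact/pres_liftD/free_scale_compatible. Qed.

Lemma morphD0 (U V : zmodType) (f : U -> V) : {morph f : u v / u + v} -> f 0 = 0.
Proof. by move=> fD; apply: (@addrI _ (f 0)); rewrite -fD !addr0. Qed.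

Lemma morphDN (U V : zmodType) (f : U -> V) :
  {morph f : u v / u + v} -> {morph f : u / - u}.
Proof.
by move=> fD u; apply: (@addrI _ (f u)); rewrite -fD !subrr (morphD0 fD).
Qed.

Lemma free_mod_eq (V : zmodType) (f g : free_mod -> V) :
  {morph f : u v / u + v} -> {morph g : u v / u + v} ->
  (forall a x, f (free_term a x) = g (free_term a x)) -> f =1 g.
Proof.
move=> fD gD fg; elim/free_mod_ind => //.
- by rewrite !morphD0.
- by move=> u v fu fv; rewrite fD gD fu fv.
- by move=> u fu; rewrite !morphDN // fu.
Qed.

Lemma free_scaleA a b v : free_scale a (free_scale b v) = free_scale (a * b) v.
Proof.
move: v; apply: free_mod_eq; try exact: free_scaleDr.
- by move=> u v; rewrite !free_scaleDr.
- by move=> c x; rewrite !free_scale_term mulrA.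
Qed.

Lemma free_scale1 : left_id 1 free_scale.
Proof.
by apply: free_mod_eq (free_scaleDr 1) _ _ => // c x; rewrite free_scale_term mul1r.
Qed.

Lemma free_scaleDl v : {morph free_scale^~ v : a b / a + b}.
Proof.
move=> a b; move: v; apply: free_mod_eq; first exact: free_scaleDr.
- by move=> u v; rewrite !free_scaleDr addrACA.
- by move=> c x; rewrite !free_scale_term mulrDl free_termD.
Qed.

HB.instance Definition _ := GRing.Zmodule_isLmodule.Build A free_mod
  free_scaleA free_scale1 free_scaleDr free_scaleDl.

Section Lift.
Variables (M : lmodType A) (v : X -> M).

Definition free_lift : free_mod -> M :=
  pres_lift (fun p : A * X => p.1 *: v p.2).

Lemma free_lift_compatible :
  compatible free_rel (fun p : A * X => p.1 *: v p.2).
Proof.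
move=> s t [a b x]; rewrite /word_eval !big_cons !big_nil /= !addr0.
by rewrite scalerDl.
Qed.

Lemma free_lift_term a x : free_lift (free_term a x) = a *: v x.
Proof. exact: (pres_lift_gen free_lift_compatible (a, x)). Qed.

Lemma free_liftD : {morph free_lift : x y / x + y}.
Proof. exact/pres_liftD/free_lift_compatible. Qed.

Lemma free_lift_linear : linear free_lift.
Proof.
move=> c u w; rewrite free_liftD; congr (_ + _).
move: u; apply: free_mod_eq => [u u'|u u'|a x].
- by rewrite scalerDr free_liftD.
- by rewrite free_liftD scalerDr.
- by rewrite -[c *: _]/(free_scale _ _) free_scale_term !free_lift_term scalerA.
Qed.

HB.instance Definition _ :=
  GRing.isLinear.Build A free_mod M *:%R free_lift free_lift_linear.

End Lift.

Lemma free_mod_projective : projective free_mod.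
Proof.
move=> M N p f p_surj.
have lft x : {y | p y = f (free_term 1 x)} by apply/cid/p_surj.
pose g : {linear free_mod -> M} := free_lift (fun x => sval (lft x)).
have gE a x : g (free_term a x) = a *: sval (lft x) by exact: free_lift_term.
exists g; apply: free_mod_eq => [u v|u v|a x]; try by rewrite !linearD.
rewrite gE linearZ /= (svalP (lft x)) -linearZ.
by rewrite -[a *: _]/(free_scale _ _) free_scale_term mulr1.
Qed.

End FreeModule.

Section ProjectiveResolution.
Variables (A : pzRingType).

Definition ker_cover (M N : lmodType A) (f : {linear M -> N}) :
    {linear free_mod A {x : M | f x == 0} -> M} :=
  free_lift val.

Lemma ker_cover_term (M N : lmodType A) (f : {linear M -> N}) a x :
  ker_cover f (free_term a x) = a *: val x.
Proof. exact: free_lift_term. Qed.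

Lemma ker_coverP (M N : lmodType A) (f : {linear M -> N}) x :
  f x = 0 <-> exists y, ker_cover f y = x.
Proof.
split=> [/eqP fx0|[y <-]].
  exists (free_term 1 (exist _ x fx0 : {x | f x == 0})).
  by rewrite ker_cover_term scale1r.
move: y; apply: (@free_mod_eq _ _ _ _ (fun=> 0)) => [u v|u v|a z].
- by rewrite !linearD.
- by rewrite addr0.
- by rewrite ker_cover_term linearZ /= (eqP (valP z)) scaler0.
Qed.

Record proj_arrow := ProjArrow {
  pa_src : lmodType A;
  pa_tgt : lmodType A;
  pa_map : {linear pa_src -> pa_tgt};
  pa_srcP : projective pa_src
}.

Fixpoint cover_seq (M : lmodType A) (i : nat) : proj_arrow :=
  match i with
  | 0 => ProjArrow (free_lift (id : M -> M)) (@free_mod_projective A M)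
  | i'.+1 => ProjArrow (ker_cover (pa_map (cover_seq M i')))
               (@free_mod_projective A _)
  end.

Lemma projective_resolution_exists (M : lmodType A) :
  inhabited (resolution (@projective A) M).
Proof.
constructor; apply: (@Resolution A (@projective A) M
  (fun i => pa_src (cover_seq M i)) (fun i => pa_map (cover_seq M i.+1))
  (pa_map (cover_seq M 0))).
- by move=> i; apply: pa_srcP.
- by move=> y; exists (free_term 1 y); rewrite -[RHS]scale1r; apply: free_lift_term.
- by move=> x; apply: ker_coverP.
- by move=> i x; apply: ker_coverP.
Qed.

End ProjectiveResolution.

Definition restr_scalars (S A : pzRingType) (phi : {rmorphism S -> A}) (M : lmodType A)
  : Type := M.

Section Restriction.
Variables (S A : pzRingType) (phi : {rmorphism S -> A}) (M : lmodType A).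

HB.instance Definition _ := GRing.Zmodule.copy (restr_scalars phi M) M.

Definition restr_scale (a : S) (x : restr_scalars phi M) : restr_scalars phi M :=
  phi a *: (x : M).

Lemma restr_scaleA a b v :
  restr_scale a (restr_scale b v) = restr_scale (a * b) v.
Proof. by rewrite /restr_scale scalerA rmorphM. Qed.

Lemma restr_scale1 : left_id 1 restr_scale.
Proof. by move=> v; rewrite /restr_scale rmorph1 scale1r. Qed.

Lemma restr_scaleDr : right_distributive restr_scale +%R.
Proof. by move=> a u v; rewrite /restr_scale scalerDr. Qed.

Lemma restr_scaleDl v : {morph restr_scale^~ v : a b / a + b}.
Proof. by move=> a b; rewrite /restr_scale rmorphD scalerDl. Qed.

HB.instance Definition _ := GRing.Zmodule_isLmodule.Build S (restr_scalars phi M)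
  restr_scaleA restr_scale1 restr_scaleDr restr_scaleDl.

End Restriction.

Section Separable.
Variables (S A : pzRingType) (phi : {rmorphism S -> A}).

Definition converse_map : S^c -> A^c := phi.

Lemma converse_map_additive : zmod_morphism converse_map.
Proof. exact: (rmorphB phi). Qed.

Lemma converse_map_monoid : monoid_morphism converse_map.
Proof. by split=> [|a b]; [apply: (rmorph1 phi)|apply: (rmorphM phi)]. Qed.

HB.instance Definition _ :=
  GRing.isZmodMorphism.Build S^c A^c converse_map converse_map_additive.
HB.instance Definition _ :=
  GRing.isMonoidMorphism.Build S^c A^c converse_map converse_map_monoid.

(* [A] as a right and as a left module over [S] *)
Definition right_reg : lmodType S^c := restr_scalars converse_map (A^c)^o.
Definition left_reg : lmodType S := restr_scalars phi A^o.

Definition ext_tens (a b : A) : tensor right_reg left_reg :=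
  @tens S right_reg left_reg a b.

(* The element sum of the p.1 (x) p.2, for p in s, is a separability element
   of the extension [A] of [S] along [phi]. *)
Definition separable : Prop :=
  exists s : seq (A * A),
    (forall a : A, \sum_(p <- s) ext_tens p.1 (p.2 * a)
                   = \sum_(p <- s) ext_tens (a * p.1) p.2)
    /\ \sum_(p <- s) p.1 * p.2 = 1.

Lemma ext_tens_bal (a : A) (c : S) (b : A) :
  ext_tens (a * phi c) b = ext_tens a (phi c * b).
Proof. exact: (@tens_bal S right_reg left_reg a c b). Qed.

End Separable.

(* Ring endomorphisms suffice: [ract1] and [ractM] make them bijective. *)
Record ring_action (G : finGroupType) (R : pzRingType) := RingAction {
  ract :> G -> {rmorphism R -> R};
  ract1 : forall r, ract 1%g r = r;
  ractM : forall (g h : G) r, ract (g * h)%g r = ract g (ract h r)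
}.

(* The functions G -> R: the coefficients in the basis [G] *)
Definition skew_ring (G : finGroupType) (R : pzRingType) (alpha : ring_action G R)
  : Type := {ffun G -> R}.

Section SkewGroupRing.
Variables (G : finGroupType) (R : pzRingType) (alpha : ring_action G R).

HB.instance Definition _ := GRing.Zmodule.copy (skew_ring alpha) {ffun G -> R}.

(* [a] times the basis element [g] *)
Definition skew_term (a : R) (g : G) : skew_ring alpha :=
  [ffun k => if k == g then a else 0].

Definition skew_one : skew_ring alpha := skew_term 1 1%g.

(* The coefficient at k collects the products a g(b) with g h = k. *)
Definition skew_mul (x y : skew_ring alpha) : skew_ring alpha :=
  [ffun k => \sum_(g : G) x g * alpha g (y (g^-1 * k)%g)].

Lemma skew_mulA : associative skew_mul.
Proof.
move=> x y z; apply/ffunP=> k; rewrite !ffunE.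
under eq_bigr => g _.
  rewrite ffunE rmorph_sum mulr_sumr (reindex_inj (mulgI g^-1%g)) /=.
  under eq_bigr => h _ do
    rewrite rmorphM mulrA -ractM mulKVg invMg invgK -mulgA mulKVg.
  over.
rewrite exchange_big /=; apply: eq_bigr => h _.
by rewrite ffunE mulr_suml.
Qed.

Lemma skew_mul1 : left_id skew_one skew_mul.
Proof.
move=> x; apply/ffunP=> k; rewrite ffunE (bigD1 1%g) //= big1 => [|g /negbTE g1].
  by rewrite ffunE eqxx mul1r ract1 invg1 mul1g addr0.
by rewrite ffunE g1 mul0r.
Qed.

Lemma skew_mulr1 : right_id skew_one skew_mul.
Proof.
move=> x; apply/ffunP=> k; rewrite ffunE (bigD1 k) //= big1 => [|g gk].
  by rewrite ffunE mulVg eqxx rmorph1 mulr1 addr0.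
rewrite ffunE -(inj_eq (mulgI g)) mulKVg mulg1 eq_sym (negbTE gk).
by rewrite rmorph0 mulr0.
Qed.

Lemma skew_mulDl : left_distributive skew_mul +%R.
Proof.
move=> x y z; apply/ffunP=> k; rewrite !ffunE -big_split /=.
by apply: eq_bigr => g _; rewrite ffunE mulrDl.
Qed.

Lemma skew_mulDr : right_distributive skew_mul +%R.
Proof.
move=> x y z; apply/ffunP=> k; rewrite !ffunE -big_split /=.
by apply: eq_bigr => g _; rewrite ffunE rmorphD mulrDr.
Qed.

HB.instance Definition _ := GRing.Zmodule_isPzRing.Build (skew_ring alpha)
  skew_mulA skew_mul1 skew_mulr1 skew_mulDl skew_mulDr.

Lemma skew_mul_term (a b : R) (g h : G) :
  skew_term a g * skew_term b h = skew_term (a * alpha g b) (g * h)%g.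
Proof.
apply/ffunP=> k; rewrite !ffunE (bigD1 g) //= big1 => [|g' /negbTE g'g].
  rewrite addr0 !ffunE eqxx -(inj_eq (mulgI g)) mulKVg.
  by case: (k == _) => //; rewrite rmorph0 mulr0.
by rewrite ffunE g'g mul0r.
Qed.

End SkewGroupRing.

Section Subgroup.
Variables (G : finGroupType) (R : pzRingType) (alpha : ring_action G R).
Variable H : {group G}.

Definition restr_action : ring_action (subg_of H) R :=
  @RingAction _ R (fun h => alpha (sgval h)) (ract1 alpha)
    (fun g h => ractM alpha (sgval g) (sgval h)).

(* The inclusion of RH in RG, sending h to h *)
Definition skew_incl (x : skew_ring restr_action) : skew_ring alpha :=
  \sum_(h : subg_of H) skew_term alpha (x h) (sgval h).

Lemma skew_inclE (x : skew_ring restr_action) g :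
  skew_incl x g = \sum_(h : subg_of H | sgval h == g) x h.
Proof.
rewrite /skew_incl sum_ffunE [RHS]big_mkcond; apply: eq_bigr => h _.
by rewrite ffunE eq_sym.
Qed.

Lemma skew_incl_in (x : skew_ring restr_action) (h : subg_of H) :
  skew_incl x (sgval h) = x h.
Proof.
by rewrite skew_inclE (eq_bigl (pred1 h)) ?big_pred1_eq.
Qed.

Lemma skew_incl_out (x : skew_ring restr_action) g : g \notin H -> skew_incl x g = 0.
Proof.
by move=> gH; rewrite skew_inclE big1 // => h /eqP hg; rewrite -hg subgP in gH.
Qed.

Lemma skew_incl_inj : injective skew_incl.
Proof.
by move=> x y xy; apply/ffunP=> h; rewrite -!skew_incl_in xy.
Qed.

Lemma skew_incl_additive : zmod_morphism skew_incl.
Proof.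
move=> x y; apply/ffunP=> g; rewrite [RHS]ffunE [(- _ : skew_ring _) _]ffunE.
rewrite !skew_inclE -sumrB; apply: eq_bigr => h _.
by rewrite [LHS]ffunE [(- _ : skew_ring _) _]ffunE.
Qed.

Lemma skew_incl_monoid : monoid_morphism skew_incl.
Proof.
have inH g : g \in H -> exists h : subg_of H, g = sgval h.
  by move=> gH; exists (subg H g); rewrite subgK.
split=> [|x y]; apply/ffunP=> g.
  case: (boolP (g \in H)) => [/inH[h ->]|gH].
    by rewrite skew_incl_in !ffunE -(inj_eq val_inj).
  rewrite skew_incl_out // ffunE ifN //.
  by apply: contra gH => /eqP ->; apply: group1.
case: (boolP (g \in H)) => [/inH[h ->]|gH].
  rewrite skew_incl_in !ffunE [RHS](bigID [in H]) /=.
  rewrite [X in _ + X]big1 ?addr0 => [|k kH]; last by rewrite skew_incl_out ?mul0r.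
  rewrite [RHS](reindex (@sgval G H)) /=; last first.
    by exists (subg H) => k kH; [apply: sgvalK | apply: subgK].
  rewrite [RHS](eq_bigl predT) => [|k]; last exact: subgP.
  by apply: eq_bigr => k _; rewrite -!skew_incl_in.
rewrite skew_incl_out // ffunE big1 // => k _.
case: (boolP (k \in H)) => kH; last by rewrite skew_incl_out ?mul0r.
by rewrite [X in alpha k X]skew_incl_out ?rmorph0 ?mulr0 // groupMl ?groupV.
Qed.

HB.instance Definition _ := GRing.isZmodMorphism.Build
  (skew_ring restr_action) (skew_ring alpha) skew_incl skew_incl_additive.
HB.instance Definition _ := GRing.isMonoidMorphism.Build
  (skew_ring restr_action) (skew_ring alpha) skew_incl skew_incl_monoid.

End Subgroup.

Arguments skew_incl {G R} alpha H x.

(* Main.v *)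
(* [RG] is free over [RH], on the left and on the right, with dual bases: the
   representatives [g] of the right cosets [H g], and their inverses, for the
   pairing [(a, b) |-> p (a b)] where [p : RG -> RH] forgets the coefficients
   outside [H].  Hence induction and restriction between [RH]-modules and
   [RG]-modules are exact and preserve projectivity and flatness, so they map
   projective resolutions to such, and do not increase flat dimensions.
   - An [RH]-module [M] is naturally an [RH]-summand of [RG (x) M], so a cocycle
     with values in [M] bounds as soon as the induced cocycle does.
   - If [sum a_i (x) b_i] is a separability element and the [RG]-linear cocycle
     [f] is [g d] with [g] only [RH]-linear, then [f] is also [g' d] with
     [g' z = sum a_i g (b_i z)], which is [RG]-linear. *)
Require Import Defs.
From HB Require Import structures.
From mathcomp Require Import all_boot all_order all_algebra all_fingroup.

Set Implicit Arguments.
Unset Strict Implicit.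
Unset Printing Implicit Defensive.

Import GRing.Theory.

Local Open Scope ring_scope.

Lemma morphD_sum (U V : zmodType) (f : U -> V) :
  {morph f : u v / u + v} ->
  forall (I : Type) (r : seq I) (P : pred I) (F : I -> U),
  f (\sum_(i <- r | P i) F i) = \sum_(i <- r | P i) f (F i).
Proof. by move=> fD I r P F; exact: (big_morph f fD (morphD0 fD)). Qed.

Lemma enat_le_anti (x y : enat) : (x <= y)%enat -> (y <= x)%enat -> x = y.
Proof.
by case: x y => [x|] [y|] //= xy yx; congr Some; apply/eqP; rewrite eqn_leq xy.
Qed.

(** * Universal property of the tensor product, and flatness by retraction *)

Section TensorLift.
Variables (A : pzRingType) (N : lmodType A^c) (M : lmodType A) (V : zmodType).

Record balanced (b : N -> M -> V) : Prop := Balanced {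
  balancedDl : forall x x' y, b (x + x') y = b x y + b x' y;
  balancedDr : forall x y y', b x (y + y') = b x y + b x y';
  balancedZ : forall x (a : A) y, b ((a : A^c) *: x) y = b x (a *: y)
}.

Definition tensor_lift (b : N -> M -> V) : tensor N M -> V :=
  pres_lift (fun p : N * M => b p.1 p.2).

Lemma balanced_compatible (b : N -> M -> V) : balanced b ->
  compatible (@tensor_rel A N M) (fun p : N * M => b p.1 p.2).
Proof.
move=> [bDl bDr bZ] s t [x x' y|x y y'|x a y].
- by rewrite /word_eval !big_cons !big_nil /= !addr0 bDl.
- by rewrite /word_eval !big_cons !big_nil /= !addr0 bDr.
- by rewrite /word_eval !big_cons !big_nil /= !addr0 bZ.
Qed.

Lemma tensor_liftD (b : N -> M -> V) : balanced b ->
  {morph tensor_lift b : u v / u + v}.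
Proof. by move=> bb; apply/pres_liftD/balanced_compatible. Qed.

Lemma tensor_lift_tens (b : N -> M -> V) x y : balanced b ->
  tensor_lift b (tens x y) = b x y.
Proof. by move=> bb; apply: (pres_lift_gen (balanced_compatible bb) (x, y)). Qed.

(** Every tensor is a signed sum of pure tensors. *)
Lemma tensor_eq (f g : tensor N M -> V) :
  {morph f : u v / u + v} -> {morph g : u v / u + v} ->
  (forall x y, f (tens x y) = g (tens x y)) -> f =1 g.
Proof.
move=> fD gD fg u; rewrite -[u]pres_ofK pres_of_sum !morphD_sum //.
apply: eq_bigr => -[b [x y]] _ /=.
by case: b; rewrite ?(morphDN fD) ?(morphDN gD) fg.
Qed.

End TensorLift.

Lemma tens_suml (A : pzRingType) (N : lmodType A^c) (M : lmodType A) (I : finType)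
    (F : I -> N) (y : M) : tens (\sum_i F i) y = \sum_i tens (F i) y.
Proof. exact: (morphD_sum (fun u v => tensDl u v y)). Qed.

Lemma tens_sumr (A : pzRingType) (N : lmodType A^c) (M : lmodType A) (I : finType)
    (x : N) (F : I -> M) : tens x (\sum_i F i) = \sum_i tens x (F i).
Proof. exact: (morphD_sum (tensDr x)). Qed.

(* A flatness criterion: [N (x) F] is additively and naturally a retract of
   [T N (x) F'], where [T] preserves injections. *)
Lemma flat_retract (A B : pzRingType) (F : lmodType A) (F' : lmodType B)
    (T : lmodType A^c -> lmodType B^c)
    (Tm : forall N' N : lmodType A^c, {linear N' -> N} -> {linear T N' -> T N})
    (b : forall N : lmodType A^c, N -> F -> tensor (T N) F')
    (c : forall N : lmodType A^c, T N -> F' -> tensor N F) :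
  (forall (N' N : lmodType A^c) (f : {linear N' -> N}), injective f -> injective (Tm N' N f)) ->
  (forall N, balanced (b N)) -> (forall N, balanced (c N)) ->
  (forall N x y, tensor_lift (c N) (b N x y) = tens x y) ->
  (forall (N' N : lmodType A^c) (f : {linear N' -> N}) x y,
     b N (f x) y = tensor_map (Tm N' N f) (b N' x y)) ->
  flat F' -> flat F.
Proof.
move=> Tinj bb cb cbK bn fF' N' N f finj u v fuv.
have bK : cancel (tensor_lift (b N')) (tensor_lift (c N')).
  apply: tensor_eq => [s t|//|x y]; first by rewrite !tensor_liftD.
  by rewrite tensor_lift_tens.
have bnat w : tensor_lift (b N) (tensor_map f w)
              = tensor_map (Tm N' N f) (tensor_lift (b N') w).
  move: w; apply: tensor_eq => [s t|s t|x y].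
  - by rewrite tensor_mapD tensor_liftD.
  - by rewrite tensor_liftD // tensor_mapD.
  - by rewrite tensor_map_tens !tensor_lift_tens // bn.
(* The lift of [b N'] is injective by [bK], and by naturality it carries the equality to one between
   images under [Tm f (x) F'], which is injective since [F'] is flat. *)
apply: (can_inj bK); apply: (fF' _ _ _ (Tinj _ _ _ finj)).
by rewrite -!bnat fuv.
Qed.

(** * Exact functors acting on resolutions, and comparison of global dimensions *)

Definition surjective_fun (T U : Type) (f : T -> U) := forall y, exists x, f x = y.

Definition exact_at (U V W : zmodType) (f : U -> V) (g : V -> W) :=
  forall x, g x = 0 <-> exists y, f y = x.

(** The fields match the uses: [ef_surj] handles the augmentation of a resolution, [ef_exact] its
    other terms, and [ef_zero] its length. *)
Record exact_functor (A B : pzRingType) := ExactFunctor {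
  ef_obj :> lmodType A -> lmodType B;
  ef_map : forall M N : lmodType A, {linear M -> N} -> {linear ef_obj M -> ef_obj N};
  ef_surj : forall (M N : lmodType A) (f : {linear M -> N}),
    surjective_fun f -> surjective_fun (ef_map f);
  ef_exact : forall (M N P : lmodType A) (f : {linear M -> N}) (g : {linear N -> P}),
    exact_at f g -> exact_at (ef_map f) (ef_map g);
  ef_zero : forall M : lmodType A, (forall x : M, x = 0) -> forall x : ef_obj M, x = 0
}.

Definition resolution_map (A B : pzRingType) (T : exact_functor A B)
    (Q : lmodType A -> Prop) (Q' : lmodType B -> Prop)
    (TQ : forall M, Q M -> Q' (T M)) (M : lmodType A) (C : resolution Q M) :
    resolution Q' (T M) :=
  @Resolution B Q' (T M) (fun i => T (C i)) (fun i => ef_map T (res_d C i))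
    (ef_map T (res_aug C)) (fun i => TQ _ (res_objP C i))
    (ef_surj (@res_aug_surj _ _ _ C)) (ef_exact (@res_exact0 _ _ _ C))
    (fun i => ef_exact (@res_exact _ _ _ C i)).

Lemma flat_dim_map (A B : pzRingType) (T : exact_functor A B) (n : nat)
    (M : lmodType A) :
  (forall F : lmodType A, flat F -> flat (T F)) ->
  (flat_dim M <= Some n)%enat -> (flat_dim (T M) <= Some n)%enat.
Proof.
move=> Tflat /enat_minP[k le_kn [C C0]]; apply/enat_minP; exists k => //.
by exists (resolution_map Tflat C) => i ki; apply/ef_zero/C0.
Qed.

(** The condition on [k] whose least solution is [nCtd n M]. *)
Definition Ext_flat_vanishes (A : pzRingType) (n k : nat) (M : lmodType A) : Prop :=
  forall F : lmodType A, (flat_dim F <= Some n)%enat -> Ext_vanishes k.+1 F M.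

(** The hypothesis transports each admissible [k] from [T M] to [M] unchanged, so [nCtd n M] is at
    most [nCtd n (T M)]. *)
Lemma nCt_gldim_le (A B : pzRingType) (n : nat) (T : lmodType B -> lmodType A) :
  (forall (M : lmodType B) k, Ext_flat_vanishes n k (T M) -> Ext_flat_vanishes n k M) ->
  (nCt_gldim n B <= nCt_gldim n A)%enat.
Proof.
move=> TP; apply: enat_sup_least => M.
case gA: (nCt_gldim n A) => [m|]; last by case: (nCtd n M).
have: (nCtd n (T M) <= Some m)%enat.
  by rewrite -gA; apply: (enat_sup_ub (fun M : lmodType A => nCtd n M)).
by move=> /enat_minP[k km] /TP kM; apply/enat_minP; exists k.
Qed.

(** * Restriction of scalars as an exact functor *)

Section Restriction.
Variables (S A : pzRingType) (phi : {rmorphism S -> A}).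

Section Map.
Variables (M N : lmodType A) (f : {linear M -> N}).

Definition restr_map (x : restr_scalars phi M) : restr_scalars phi N := f x.

Lemma restr_map_linear : linear restr_map.
Proof. by move=> a u v; rewrite /restr_map [LHS](linearP f). Qed.

HB.instance Definition _ := GRing.isLinear.Build S (restr_scalars phi M)
  (restr_scalars phi N) *:%R restr_map restr_map_linear.

End Map.

Definition restr_functor : exact_functor A S.
Proof.
exists (fun M => restr_scalars phi M) (fun M N f => restr_map f : {linear _ -> _}).
- by move=> M N f.
- by move=> M N P f g.
- by move=> M.
Defined.

End Restriction.

(* [A] is free over [S] with left basis [y i] and right basis [x i], and these
   bases are dual to each other for the pairing [(a, b) |-> proj (a * b)]. *)
Record frobenius (S A : pzRingType) (phi : {rmorphism S -> A}) := Frobenius {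
  frob_idx : finType;
  frob_proj : A -> S;
  frob_x : frob_idx -> A;
  frob_y : frob_idx -> A;
  frob_projD : {morph frob_proj : a b / a + b};
  frob_projl : forall s a, frob_proj (phi s * a) = s * frob_proj a;
  frob_projr : forall a s, frob_proj (a * phi s) = frob_proj a * s;
  frob_proj1 : frob_proj 1 = 1;
  frob_expandl : forall a, \sum_i phi (frob_proj (a * frob_x i)) * frob_y i = a;
  frob_expandr : forall a, \sum_i frob_x i * phi (frob_proj (frob_y i * a)) = a;
  frob_dual : forall i j, frob_proj (frob_y i * frob_x j) = (i == j)%:R
}.

(** Left-right symmetry: passing to converse rings exchanges the two bases. This allows induction to
    be applied to right modules as well. *)
Definition frob_converse (S A : pzRingType) (phi : {rmorphism S -> A})
    (e : frobenius phi) : frobenius (converse_map phi : {rmorphism S^c -> A^c}).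
Proof.
apply: (@Frobenius S^c A^c (converse_map phi : {rmorphism S^c -> A^c})
  (frob_idx e) (@frob_proj _ _ _ e) (@frob_y _ _ _ e) (@frob_x _ _ _ e)).
- exact: (@frob_projD _ _ _ e).
- by move=> s a; apply: (@frob_projr _ _ _ e).
- by move=> a s; apply: (@frob_projl _ _ _ e).
- exact: (@frob_proj1 _ _ _ e).
- exact: (@frob_expandr _ _ _ e).
- exact: (@frob_expandl _ _ _ e).
- by move=> i j; rewrite eq_sym; apply: (@frob_dual _ _ _ e).
Defined.

(* The model of [A (x)_S M] in which [u] stands for the sum of the
   [x i (x) u i]. *)
Definition induced (S A : pzRingType) (phi : {rmorphism S -> A}) (e : frobenius phi)
  (M : lmodType S) : Type := {ffun frob_idx e -> M}.

(** * Induction, its two adjunctions with restriction, and projectivity *)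

Section Induction.
Variables (S A : pzRingType) (phi : {rmorphism S -> A}) (e : frobenius phi).
Local Notation I := (frob_idx e).
Local Notation p := (@frob_proj _ _ _ e).
Local Notation x := (@frob_x _ _ _ e).
Local Notation y := (@frob_y _ _ _ e).

Lemma frob_proj_sum (J : finType) (F : J -> A) : p (\sum_j F j) = \sum_j p (F j).
Proof. exact/morphD_sum/frob_projD. Qed.

(** Expand [b] in the right basis [x i] and pull the coefficients out of [p] on the right. Taking
    [a] or [b] equal to 1 gives the other contractions used below. *)
Lemma frob_projM a b : \sum_i p (a * x i) * p (y i * b) = p (a * b).
Proof.
rewrite -[b in RHS](frob_expandr e) mulr_sumr frob_proj_sum.
by apply: eq_bigr => i _; rewrite mulrA frob_projr.
Qed.

Section Module.
Variable M : lmodType S.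

HB.instance Definition _ := GRing.Zmodule.copy (induced e M) {ffun I -> M}.

(** Since [a * x j] is the sum of the [x i * phi (p (y i * a * x j))], moving these coefficients
    across the tensor sign makes [a] act as this matrix. *)
Definition ind_scale (a : A) (u : induced e M) : induced e M :=
  [ffun i => \sum_j p (y i * a * x j) *: u j].

Lemma ind_scaleA a b u : ind_scale a (ind_scale b u) = ind_scale (a * b) u.
Proof.
apply/ffunP=> i; rewrite !ffunE.
under eq_bigr => j _.
  rewrite ffunE scaler_sumr.
  under eq_bigr => k _ do rewrite scalerA -[y j * b * _]mulrA.
  over.
rewrite exchange_big /=; apply: eq_bigr => k _.
by rewrite -scaler_suml frob_projM !mulrA.
Qed.

Lemma ind_scale1 : left_id 1 ind_scale.
Proof.
move=> u; apply/ffunP=> i; rewrite ffunE (bigD1 i) //= big1 => [|j ji].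
  by rewrite mulr1 frob_dual eqxx scale1r addr0.
by rewrite mulr1 frob_dual eq_sym (negbTE ji) scale0r.
Qed.

Lemma ind_scaleDr : right_distributive ind_scale +%R.
Proof.
move=> a u v; apply/ffunP=> i; rewrite !ffunE -big_split /=.
by apply: eq_bigr => j _; rewrite ffunE scalerDr.
Qed.

Lemma ind_scaleDl u : {morph ind_scale^~ u : a b / a + b}.
Proof.
move=> a b; apply/ffunP=> i; rewrite !ffunE -big_split /=.
by apply: eq_bigr => j _; rewrite mulrDr mulrDl frob_projD scalerDl.
Qed.

HB.instance Definition _ := GRing.Zmodule_isLmodule.Build A (induced e M)
  ind_scaleA ind_scale1 ind_scaleDr ind_scaleDl.

Lemma ind_scaleE (a : A) (u : induced e M) i :
  (a *: u) i = \sum_j p (y i * a * x j) *: u j.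
Proof. by rewrite [LHS]ffunE. Qed.

Lemma ind_addE (u v : induced e M) i : (u + v) i = u i + v i.
Proof. by rewrite [LHS]ffunE. Qed.

Lemma ind_sumE (J : finType) (F : J -> induced e M) i :
  (\sum_j F j) i = \sum_j F j i.
Proof. exact: (morphD_sum (f := fun u : induced e M => u i) (fun u v => ind_addE u v i)). Qed.

Lemma ind0E i : (0 : induced e M) i = 0.
Proof. by rewrite [LHS]ffunE. Qed.

(* [m |-> 1 (x) m] *)
Definition ind_unit (m : M) : restr_scalars phi (induced e M) :=
  [ffun i => p (y i) *: m] : induced e M.

(** These are the coordinates of the pure tensor a (x) m. *)
Lemma ind_scale_unit (a : A) m i : (a *: (ind_unit m : induced e M)) i = p (y i * a) *: m.
Proof.
rewrite ind_scaleE -[a in RHS]mulr1 mulrA -frob_projM scaler_suml.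
by apply: eq_bigr => j _; rewrite ffunE scalerA mulr1.
Qed.

Lemma ind_unit_linear : linear ind_unit.
Proof.
move=> s m m'; apply/ffunP=> i.
rewrite [RHS]ind_addE [X in _ = X + _]ind_scale_unit !ffunE.
by rewrite frob_projr scalerDr scalerA.
Qed.

HB.instance Definition _ := GRing.isLinear.Build S M
  (restr_scalars phi (induced e M)) *:%R ind_unit ind_unit_linear.

(* [a (x) m |-> proj a *: m] *)
Definition ind_retract (u : restr_scalars phi (induced e M)) : M :=
  \sum_i p (x i) *: (u : induced e M) i.

Lemma ind_retract_scale a (u : induced e M) :
  ind_retract (a *: u) = \sum_j p (a * x j) *: u j.
Proof.
rewrite /ind_retract.
under eq_bigr => i _ do rewrite ind_scaleE scaler_sumr.
rewrite exchange_big /=; apply: eq_bigr => j _.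
under eq_bigr => i _ do rewrite scalerA -mulrA -[x i]mul1r.
by rewrite -scaler_suml frob_projM mul1r.
Qed.

Lemma ind_retract_linear : linear ind_retract.
Proof.
move=> s u v.
have rD (u' v' : induced e M) : ind_retract (u' + v') = ind_retract u' + ind_retract v'.
  rewrite /ind_retract -big_split; apply: eq_bigr => i _.
  by rewrite ind_addE scalerDr.
rewrite [LHS]rD [X in X + _]ind_retract_scale; congr (_ + _).
rewrite scaler_sumr; apply: eq_bigr => j _.
by rewrite frob_projl scalerA.
Qed.

HB.instance Definition _ := GRing.isLinear.Build S
  (restr_scalars phi (induced e M)) M *:%R ind_retract ind_retract_linear.

(** The composite is multiplication by the sum of the [p (x i) * p (y i)], which is [p 1], hence 1.
    So [M] is an [S]-summand of its induced module. *)
Lemma ind_unitK : cancel ind_unit ind_retract.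
Proof.
move=> m; rewrite /ind_retract.
under eq_bigr => i _ do rewrite ffunE scalerA -[x i]mul1r -[y i]mulr1.
by rewrite -scaler_suml frob_projM mul1r frob_proj1 scale1r.
Qed.

Lemma ind_expand (u : induced e M) : \sum_i x i *: (ind_unit (u i) : induced e M) = u.
Proof.
apply/ffunP=> i; rewrite ind_sumE (bigD1 i) //= big1 => [|j ji].
  by rewrite ind_scale_unit frob_dual eqxx scale1r addr0.
by rewrite ind_scale_unit frob_dual eq_sym (negbTE ji) scale0r.
Qed.

End Module.

Section Map.
Variables (M N : lmodType S) (f : {linear M -> N}).

Definition ind_map (u : induced e M) : induced e N := [ffun i => f (u i)].

Lemma ind_map_linear : linear ind_map.
Proof.
move=> a u v; apply/ffunP=> i.
rewrite ind_addE ind_scaleE !ffunE linearD linear_sum; congr (_ + _).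
by apply: eq_bigr => j _; rewrite linearZ ffunE.
Qed.

HB.instance Definition _ := GRing.isLinear.Build A (induced e M)
  (induced e N) *:%R ind_map ind_map_linear.

Lemma ind_map_unit m : ind_map (ind_unit m) = ind_unit (f m).
Proof. by apply/ffunP=> i; rewrite !ffunE linearZ. Qed.

Lemma ind_retract_map u : ind_retract (ind_map u) = f (ind_retract u).
Proof.
rewrite /ind_retract linear_sum; apply: eq_bigr => i _.
by rewrite ffunE linearZ.
Qed.

Lemma ind_map_inj : injective f -> injective ind_map.
Proof.
move=> finj u v /ffunP uv; apply/ffunP=> i; apply: finj.
by have := uv i; rewrite !ffunE.
Qed.

End Map.

Definition ind_functor : exact_functor S A.
Proof.
exists (fun M => induced e M) (fun M N f => ind_map f : {linear _ -> _}).
- move=> M N f fs u.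
  have [v vE] := fin_all_exists (fun i : I => fs (u i)).
  by exists ([ffun i => v i] : induced e M); apply/ffunP=> i; rewrite !ffunE.
- move=> M N P f g fg u; split=> [/ffunP gu|[v <-]].
    have [|v vE] := @fin_all_exists I (fun=> M) (fun i m => f m = u i).
      by move=> i; apply/fg; have := gu i; rewrite ind0E ffunE.
    by exists ([ffun i => v i] : induced e M); apply/ffunP=> i; rewrite !ffunE.
  by apply/ffunP=> i; rewrite !ffunE; apply/fg; exists (v i).
- by move=> M M0 u; apply/ffunP=> i; rewrite ind0E; apply: M0.
Defined.

Section Adjunction.
Variables (M : lmodType S) (N : lmodType A).

Section Extend.
Variable f : {linear M -> restr_scalars phi N}.

(** The map a (x) m |-> a f(m), the transpose of [f] under the adjunction with induction on the
    left. *)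
Definition ind_extend (u : induced e M) : N := \sum_i x i *: (f (u i) : N).

Lemma ind_extend_linear : linear ind_extend.
Proof.
move=> a u v; rewrite /ind_extend.
under eq_bigr => i _ do rewrite ind_addE linearD scalerDr.
rewrite big_split /=; congr (_ + _); rewrite scaler_sumr.
under eq_bigr => i _.
  rewrite ind_scaleE linear_sum scaler_sumr.
  under eq_bigr => j _ do
    rewrite linearZ /= [X in _ *: X]/(_ *: _) /= scalerA -[y i * a * _]mulrA.
  over.
rewrite exchange_big /=; apply: eq_bigr => j _.
by rewrite -scaler_suml frob_expandr scalerA.
Qed.

HB.instance Definition _ := GRing.isLinear.Build A (induced e M) N *:%R
  ind_extend ind_extend_linear.
End Extend.

Section Coextend.
Variable f : {linear restr_scalars phi N -> M}.

(** The transpose of [f] under the other adjunction: induction is also right adjoint to restriction,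
    with the maps n |-> f(a n) recorded by their values at the left basis [y i]. *)
Definition ind_coextend (n : N) : induced e M := [ffun i => f (y i *: n)].

Lemma ind_coextend_linear : linear ind_coextend.
Proof.
move=> a m n; apply/ffunP=> i.
rewrite ind_addE ind_scaleE !ffunE scalerDr [LHS](linearD f); congr (_ + _).
rewrite scalerA -[y i * a in LHS](frob_expandl e) scaler_suml.
rewrite [LHS](linear_sum f); apply: eq_bigr => j _.
by rewrite ffunE -scalerA; apply: (linearZ_LR f).
Qed.

HB.instance Definition _ := GRing.isLinear.Build A N (induced e M) *:%R
  ind_coextend ind_coextend_linear.
End Coextend.

End Adjunction.

(** Restrict [f] along the unit, lift over [S], and extend the lift back to an [A]-linear map. *)
Lemma ind_projective (P : lmodType S) : projective P -> projective (induced e P).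
Proof.
move=> projP M N q f q_surj.
pose f1 : {linear P -> restr_scalars phi N} :=
  (restr_map f : {linear restr_scalars phi (induced e P) -> restr_scalars phi N})
  \o @ind_unit P.
have [g gE] := projP _ _ (restr_map q : {linear restr_scalars phi M -> _}) f1 q_surj.
exists (ind_extend g) => u.
rewrite -[in RHS](ind_expand u) !linear_sum; apply: eq_bigr => i _.
by rewrite !linearZ; congr (_ *: _); apply: gE.
Qed.

(** Restriction is left adjoint to induction, which preserves surjections: lift the transpose of [f]
    through the induced map of [q], then apply the counit [ind_retract]. *)
Lemma restr_projective (P : lmodType A) :
  projective P -> projective (restr_scalars phi P).
Proof.
move=> projP M N q f q_surj.
have [g gE] := projP _ _ (ef_map ind_functor q) (ind_coextend f)
  (ef_surj q_surj).
pose g1 : {linear restr_scalars phi P -> M} :=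
  @ind_retract M \o (restr_map g : {linear _ -> restr_scalars phi (induced e M)}).
exists g1 => m; rewrite -[LHS]ind_retract_map.
rewrite [ind_map _ _]gE /ind_retract.
under eq_bigr => i _ do rewrite ffunE -linearZ.
rewrite -linear_sum; congr (f _).
(* The left expansion of 1 says that the [phi (p (x i)) * y i] sum to 1. *)
rewrite -[RHS](scale1r (m : P)) -[1](frob_expandl e) scaler_suml.
by apply: eq_bigr => i _; rewrite mul1r -scalerA.
Qed.

End Induction.

(** * Induction and restriction preserve flatness *)

Section Flatness.
Variables (S A : pzRingType) (phi : {rmorphism S -> A}) (e : frobenius phi).
Local Notation p := (@frob_proj _ _ _ e).
Local Notation x := (@frob_x _ _ _ e).
Local Notation y := (@frob_y _ _ _ e).
Let ec := frob_converse e.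
Let phic : {rmorphism S^c -> A^c} := converse_map phi.

(* [N (x)_A (A (x)_S F) = N (x)_S F] *)
Lemma ind_flat (F : lmodType S) : flat F -> flat (induced e F).
Proof.
pose T (N : lmodType A^c) : lmodType S^c := restr_scalars phic N.
(* With [u] read as the sum of the x_i (x) u_i, [b] sends m (x) u to the sum of the m x_i (x) u_i,
   and [c] sends m (x) v to m (x) (1 (x) v). *)
pose b (N : lmodType A^c) (m : N) (u : induced e F) : tensor (T N) F :=
  \sum_i tens ((x i : A^c) *: m : T N) (u i).
pose c (N : lmodType A^c) (m : T N) (v : F) : tensor N (induced e F) :=
  tens (m : N) (ind_unit e v : induced e F).
have bb N : balanced (b N).
  split=> [m m' u|m u u'|m a u]; rewrite /b.
  - by rewrite -big_split; apply: eq_bigr => i _; rewrite scalerDr tensDl.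
  - by rewrite -big_split; apply: eq_bigr => i _; rewrite ind_addE tensDr.
  under [RHS]eq_bigr => i _ do rewrite ind_scaleE tens_sumr.
  rewrite exchange_big /=; apply: eq_bigr => j _.
  (* For [ec] the left expansion is the right expansion over [A], here applied to [a * x j]. *)
  rewrite scalerA -[X in X *: m](frob_expandl ec) scaler_suml.
  rewrite (tens_suml (N := T N)); apply: eq_bigr => i _.
  by rewrite -tens_bal -scalerA -mulrA.
have cb N : balanced (c N).
  split=> [m m' v|m v v'|m s v]; rewrite /c.
  - exact: tensDl.
  - by rewrite linearD tensDr.
  - by rewrite linearZ /= -[in RHS]tens_bal.
apply: (@flat_retract A S (induced e F) F T
  (fun N' N f => @restr_map _ _ phic N' N f : {linear _ -> _}) b c) => //.
- move=> N m u; rewrite (morphD_sum (tensor_liftD (cb N))).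
  under eq_bigr => i _ do rewrite tensor_lift_tens // [c N _ _]tens_bal.
  by rewrite -tens_sumr ind_expand.
- move=> N' N f m u; rewrite (morphD_sum (tensor_mapD _)).
  by apply: eq_bigr => i _; rewrite tensor_map_tens -linearZ.
Qed.

(* [N (x)_S F = (N (x)_S A) (x)_A F] *)
Lemma restr_flat (F : lmodType A) : flat F -> flat (restr_scalars phi F).
Proof.
(* Over the converse rings the [y i] serve as the basis, so [u] in [T N] stands for the sum of the
   u_i (x) y_i; [c] multiplies each [y i] into [v]. *)
pose T (N : lmodType S^c) : lmodType A^c := induced ec N.
pose b (N : lmodType S^c) (m : N) (v : restr_scalars phi F) : tensor (T N) F :=
  tens (ind_unit ec m : T N) (v : F).
pose c (N : lmodType S^c) (u : T N) (v : F) : tensor N (restr_scalars phi F) :=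
  \sum_i tens (u i) (y i *: v : restr_scalars phi F).
have bb N : balanced (b N).
  split=> [m m' v|m v v'|m s v]; rewrite /b.
  - by rewrite linearD tensDl.
  - exact: tensDr.
  - by rewrite linearZ /= [LHS]tens_bal.
have cb N : balanced (c N).
  split=> [u u' v|u v v'|u a v]; rewrite /c.
  - by rewrite -big_split; apply: eq_bigr => i _; rewrite ind_addE tensDl.
  - by rewrite -big_split; apply: eq_bigr => i _; rewrite scalerDr tensDr.
  under [LHS]eq_bigr => i _ do rewrite ind_scaleE tens_suml.
  rewrite exchange_big /=; apply: eq_bigr => j _.
  rewrite scalerA -[X in X *: v](frob_expandl e) scaler_suml.
  rewrite (tens_sumr (M := restr_scalars phi F)); apply: eq_bigr => i _.
  by rewrite [LHS]tens_bal -scalerA -mulrA.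
apply: (@flat_retract S A (restr_scalars phi F) F T
  (fun N' N f => @ind_map _ _ _ ec N' N f : {linear _ -> _}) b c) => //.
- by move=> N' N f; apply: ind_map_inj.
- move=> N m v; rewrite tensor_lift_tens // /c.
  rewrite -[v in RHS](scale1r (v : F)) -[1](frob_expandl e) scaler_suml.
  rewrite (tens_sumr (M := restr_scalars phi F)); apply: eq_bigr => i _.
  by rewrite ffunE [LHS]tens_bal mul1r -scalerA.
- by move=> N' N f m v; rewrite tensor_map_tens [X in _ = tens X _]ind_map_unit.
Qed.

End Flatness.

(** * Averaging by a separability element, and transfer of Ext vanishing *)

Section Average.
Variables (S A : pzRingType) (phi : {rmorphism S -> A}).
Variable s : seq (A * A).
Hypothesis s_comm : forall a : A, \sum_(q <- s) ext_tens phi q.1 (q.2 * a)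
                                  = \sum_(q <- s) ext_tens phi (a * q.1) q.2.
Variables (P M : lmodType A).
Variable g : {linear restr_scalars phi P -> restr_scalars phi M}.

Definition average (z : P) : M := \sum_(q <- s) q.1 *: (g (q.2 *: z) : M).

Lemma average_linear : linear average.
Proof.
move=> a z w; rewrite /average scaler_sumr.
have gD (q : A * A) : q.1 *: (g (q.2 *: (a *: z + w)) : M)
    = q.1 *: (g ((q.2 * a) *: z) : M) + q.1 *: (g (q.2 *: w) : M).
  by rewrite scalerDr scalerA [X in _ *: X](linearD g); apply: scalerDr.
rewrite (eq_bigr _ (fun q _ => gD q)) big_split; congr (_ + _).
(* The map u (x) v |-> u g(v z) is well defined over [S] because [g] is [S]-linear; applied to
   [s_comm a] it moves [a] from the inside of [g] to the front. *)
pose h (u : right_reg phi) (v : left_reg phi) : M := (u : A) *: (g ((v : A) *: z) : M).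
have hb : balanced h.
  split=> [u u' v|u v v'|u c v]; rewrite /h.
  - exact: (scalerDl (g _ : M)).
  - by rewrite [X in g X]scalerDl [X in _ *: X](linearD g) [LHS](scalerDr _ (g _ : M)).
  have -> : ((c *: v : left_reg phi) : A) *: z = c *: (((v : A) *: z) : restr_scalars phi P).
    by rewrite [RHS](scalerA (phi c)).
  rewrite linearZ /=; apply: esym; exact: (scalerA (u : A) (phi c) (g _ : M)).
have hE u v : tensor_lift h (ext_tens phi u v) = h u v by apply: tensor_lift_tens hb.
have := congr1 (tensor_lift h) (s_comm a); rewrite !(morphD_sum (tensor_liftD hb)).
rewrite (eq_bigr _ (fun q _ => hE q.1 (q.2 * a))) => ->.
by apply: eq_bigr => q _; rewrite hE [RHS]scalerA.
Qed.

Definition linear_average : {linear P -> M} :=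
  HB.pack average (GRing.isLinear.Build A P M *:%R average average_linear).

End Average.

(** Restriction turns [C] into a projective resolution over [S], where the cocycle [f] bounds some
    [g]; averaging [g] makes it [A]-linear. *)
Lemma separable_Ext_flat_vanishes (S A : pzRingType) (phi : {rmorphism S -> A})
    (e : frobenius phi) (n k : nat) (M : lmodType A) :
  separable phi ->
  Ext_flat_vanishes n k (restr_scalars phi M) -> Ext_flat_vanishes n k M.
Proof.
move=> [s [s_comm s1]] RM F Fn C f fc.
have Fn' := flat_dim_map (T := restr_functor phi) (restr_flat e) Fn.
pose C' := resolution_map (T := restr_functor phi) (restr_projective e) C.
have [|g gE] := RM _ Fn' C' (restr_map f : {linear C' k.+1 -> restr_scalars phi M}).
  exact: fc.
exists (linear_average s_comm g) => z.
(* With d the differential, f(z) is the sum of the a_i f(b_i z) = a_i g(d(b_i z)) = a_i g(b_i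
   d(z)). *)
rewrite -[LHS]scale1r -s1 scaler_suml; apply: eq_bigr => q _.
rewrite -scalerA -linearZ; congr (_ *: _).
by rewrite [LHS]gE; congr (g _); apply: (linearZ_LR (res_d C k)).
Qed.

(** The induced cocycle bounds some [g]; composing [g] with the unit on [C k] and the retraction
    onto [M] gives a bound for [f], by naturality of both. *)
Lemma ind_Ext_flat_vanishes (S A : pzRingType) (phi : {rmorphism S -> A})
    (e : frobenius phi) (n k : nat) (M : lmodType S) :
  Ext_flat_vanishes n k (induced e M) -> Ext_flat_vanishes n k M.
Proof.
move=> IM F Fn C f fc.
have Fn' := flat_dim_map (T := ind_functor e) (@ind_flat _ _ _ e) Fn.
pose C' := resolution_map (T := ind_functor e) (@ind_projective _ _ _ e) C.
have [|g gE] := IM _ Fn' C' (ind_map f : {linear C' k.+1 -> induced e M}).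
  by move=> u; apply/ffunP=> i; rewrite ind0E !ffunE; apply: fc.
exists (@ind_retract _ _ _ e M \o
  (restr_map g : {linear restr_scalars phi (induced e (C k)) -> _}) \o
  @ind_unit _ _ _ e (C k)).
move=> z; rewrite -[LHS](ind_unitK e) -ind_map_unit /=; congr ind_retract.
by rewrite [LHS]gE; congr (g _); apply: ind_map_unit.
Qed.

(** * Dual bases of the skew group ring over that of a subgroup *)

Section SkewFrobenius.
Variables (G : finGroupType) (R : pzRingType) (alpha : ring_action G R).
Variable H : {group G}.
Local Notation RG := (skew_ring alpha).
Local Notation RH := (skew_ring (restr_action alpha H)).
Local Notation incl := (skew_incl alpha H : {rmorphism RH -> RG}).

Lemma skew_sum_term (a : RG) : \sum_g skew_term alpha (a g) g = a.
Proof.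
apply/ffunP=> k; rewrite sum_ffunE (bigD1 k) //= big1 => [|g gk].
  by rewrite ffunE eqxx addr0.
by rewrite ffunE eq_sym (negbTE gk).
Qed.

Lemma skew_eq_term (V : zmodType) (f f' : RG -> V) :
  {morph f : a b / a + b} -> {morph f' : a b / a + b} ->
  (forall r g, f (skew_term alpha r g) = f' (skew_term alpha r g)) -> f =1 f'.
Proof.
move=> fD f'D ff' a; rewrite -[a]skew_sum_term !morphD_sum //.
by apply: eq_bigr => g _.
Qed.

Definition skew_proj (a : RG) : RH := [ffun h => a (sgval h)].

Lemma skew_projD : {morph skew_proj : a b / a + b}.
Proof. by move=> a b; apply/ffunP=> h; rewrite !ffunE. Qed.

Lemma skew_incl_proj a g : incl (skew_proj a) g = if g \in H then a g else 0.
Proof.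
case: ifP => gH; last by rewrite skew_incl_out ?gH.
by rewrite -[g in LHS](@subgK _ H g gH) skew_incl_in ffunE subgK.
Qed.

Lemma skew_incl_proj_term r g :
  incl (skew_proj (skew_term alpha r g)) = if g \in H then skew_term alpha r g else 0.
Proof.
apply/ffunP=> k; rewrite skew_incl_proj.
case: (boolP (g \in H)) => gH; case: (boolP (k \in H)) => kH; rewrite ?ffunE //.
- by case: eqP kH => // ->; rewrite gH.
- by case: eqP gH => // <-; rewrite kH.
Qed.

(** Compare coefficients at k in RG: [s] is supported on [H], and for g in [H] the element g^-1 k
    lies in [H] exactly when k does. *)
Lemma skew_projl s a : skew_proj (incl s * a) = s * skew_proj a.
Proof.
apply: (@skew_incl_inj _ _ alpha H); rewrite [RHS]rmorphM.
apply/ffunP=> k; rewrite [LHS]skew_incl_proj !ffunE.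
case: ifPn => kH; last first.
  rewrite big1 // => g _; have [gH|gH] := boolP (g \in H).
    by rewrite skew_incl_proj groupMl ?groupV // (negbTE kH) rmorph0 mulr0.
  by rewrite [X in X * _]skew_incl_out ?mul0r.
apply: eq_bigr => g _; have [gH|gH] := boolP (g \in H).
  by rewrite skew_incl_proj groupMl ?groupV // kH.
by rewrite [X in X * _]skew_incl_out // [X in _ = X * _]skew_incl_out ?mul0r.
Qed.

Lemma skew_projr a s : skew_proj (a * incl s) = skew_proj a * s.
Proof.
apply: (@skew_incl_inj _ _ alpha H); rewrite [RHS]rmorphM.
apply/ffunP=> k; rewrite [LHS]skew_incl_proj !ffunE.
case: ifPn => kH; [apply: eq_bigr|rewrite big1 //] => g _;
  rewrite [X in _ = X * _]skew_incl_proj || rewrite [X in X * _]skew_incl_proj.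
  case: ifPn => // gH; rewrite [X in alpha g X]skew_incl_out ?rmorph0 ?mulr0 ?mul0r //.
  by rewrite groupMr // groupV.
case: ifPn => gH; last by rewrite mul0r.
by rewrite [X in alpha g X]skew_incl_out ?rmorph0 ?mulr0 // groupMl ?groupV.
Qed.

(** Right cosets are indexed by their canonical representatives, so that [val i] is directly a group
    element. *)
Definition coset_rep : finType := {g : G | g == repr (H :* g)%g}.

Lemma coset_repP g : repr (H :* g)%g == repr (H :* repr (H :* g))%g.
Proof. by have /rcoset_eqP -> := mem_repr_rcoset H g. Qed.

Lemma mem_coset_rep (i : coset_rep) g :
  (g * (val i)^-1 \in H)%g = (i == Sub (repr (H :* g)%g) (coset_repP g)).
Proof.
rewrite -mem_rcoset -val_eqE /=; apply/idP/eqP => [/rcoset_eqP ->|->].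
  by apply/eqP/(valP i).
by rewrite rcoset_sym mem_repr_rcoset.
Qed.

(** Exactly one representative lies in the coset of [g]; this collapses both basis expansions to a
    single term. *)
Lemma sum_coset_rep (V : zmodType) (v : V) g :
  \sum_(i : coset_rep) (if (g * (val i)^-1 \in H)%g then v else 0) = v.
Proof.
rewrite -big_mkcond /= (eq_bigl _ _ (fun i => mem_coset_rep i g)).
exact: big_pred1_eq.
Qed.

Definition skew_frobenius : frobenius incl.
Proof.
apply: (@Frobenius _ _ incl coset_rep skew_proj
  (fun i => skew_term alpha 1 (val i)^-1%g) (fun i => skew_term alpha 1 (val i))).
- exact: skew_projD.
- exact: skew_projl.
- exact: skew_projr.
- by apply/ffunP=> h; rewrite !ffunE.
- apply: skew_eq_term => // [a b|r g].
    rewrite -big_split; apply: eq_bigr => i _.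
    by rewrite mulrDl skew_projD rmorphD mulrDl.
  rewrite -[RHS](sum_coset_rep _ g); apply: eq_bigr => i _.
  rewrite skew_mul_term skew_incl_proj_term; case: ifP => _; last by rewrite mul0r.
  by rewrite skew_mul_term !rmorph1 !mulr1 mulgKV.
- apply: skew_eq_term => // [a b|r g].
    rewrite -big_split; apply: eq_bigr => i _.
    by rewrite mulrDr skew_projD rmorphD mulrDr.
  (* The term at i survives when g_i g is in [H], equivalently when g^-1 g_i^-1 is, hence the coset
     of the inverse. *)
  rewrite -[RHS](sum_coset_rep _ g^-1%g); apply: eq_bigr => i _.
  rewrite skew_mul_term skew_incl_proj_term -groupV invMg.
  case: ifP => _; last by rewrite mulr0.
  by rewrite skew_mul_term !mul1r -ractM mulKg mulVg ract1.
- move=> i j; apply: (@skew_incl_inj _ _ alpha H).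
  rewrite skew_mul_term skew_incl_proj_term mem_coset_rep.
  (* A representative represents its own coset, so g_i g_j^-1 lies in [H] only for i = j, where the
     product is 1. *)
  have -> : Sub (repr (H :* val i)%g) (coset_repP (val i)) = i.
    by apply/eqP; rewrite -val_eqE /= eq_sym (valP i).
  rewrite eq_sym; case: eqP => [->|_]; last by rewrite rmorph0.
  by rewrite rmorph1 mulr1 mulgV rmorph1.
Defined.

End SkewFrobenius.

Theorem corollary6p6 (R : pzRingType) (G : finGroupType)
    (alpha : ring_action G R) (H : {group G}) (n : nat) :
  let RG : pzRingType := skew_ring alpha in
  let RH : pzRingType := skew_ring (restr_action alpha H) in
  (nCt_gldim n RH <= nCt_gldim n RG)%enat
  /\ (separable (skew_incl alpha H : {rmorphism RH -> RG}) ->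
      nCt_gldim n RH = nCt_gldim n RG).
Proof.
move=> RG RH; pose e := skew_frobenius alpha H.
have le1 : (nCt_gldim n RH <= nCt_gldim n RG)%enat.
  apply: (@nCt_gldim_le RG RH n (fun M => induced e M)) => M k.
  exact: ind_Ext_flat_vanishes.
split=> // sep; apply: enat_le_anti => //.
pose phi : {rmorphism RH -> RG} := skew_incl alpha H.
apply: (@nCt_gldim_le RH RG n (fun M => restr_scalars phi M)) => M k.
exact: separable_Ext_flat_vanishes.
Qed.
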